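(* Let $G$, $H$ and $K$ be graphs. Then $$\mathrm{C}(G;K)\leq \mathrm{C}(G;H)\cdot \mathrm{C}(H;K)\quad\text{and}\quad \mathrm{IC}(G;K)\leq \mathrm{IC}(G;H)\cdot \mathrm{IC}(H;K).$$
   Context: ''Graph'' means either an undirected graph (loops allowed) or a directed graph (a set of vertices with a binary relation), without multiple edges; all graphs in the statement are of the same kind. The vertex and edge (arc) sets of $G$ are $V(G)$, $E(G)$. A homomorphism $f:G\to H$ is a map $f:V(G)\to V(H)$ with $f(u)f(v)\in E(H)$ whenever $uv\in E(G)$; it is injective if it is injective on vertices and the induced map on edges is injective (the former implies the latter). A subgraph of $G$ is a graph whose vertex and edge sets are subsets of $V(G)$, $E(G)$. The union $G_1\cup\cdots\cup G_k$ has vertex set $\bigcup_i V(G_i)$ and edge set $\bigcup_i E(G_i)$. The hom-complexity $\mathrm{C}(G;H)$ is the least positive integer $k$ such that there are subgraphs $G_1,\dots,G_k$ of $G$ with $G=G_1\cup\cdots\cup G_k$ and, for each $i$, a homomorphism $G_i\to H$; $\mathrm{C}(G;H)=\infty$ if no such $k$ exists. The injective hom-complexity $\mathrm{IC}(G;H)$ is defined in the same way, requiring for each $i$ an injective homomorphism $G_i\to H$. Products with a factor $\infty$ equal $\infty$. *)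

(* Defs.v *)
From mathcomp Require Import all_boot boolp classical_sets.

Set Implicit Arguments.
Unset Strict Implicit.
Unset Printing Implicit Defensive.

Local Open Scope classical_set_scope.

Inductive graph_kind := Undirected | Directed.

(* Graphs may be infinite or empty. An undirected edge {u, v} is encoded by
   the two pairs (u, v) and (v, u); loops (u, u) are allowed for both kinds. *)
Record graph (kd : graph_kind) : Type := Graph {
  vert :> Type;
  edges : set (vert * vert);
  edges_sym : kd = Undirected -> forall u v, edges (u, v) -> edges (v, u)
}.
Arguments edges {kd} g _.

Record subgraph (kd : graph_kind) (G : graph kd) : Type := Subgraph {
  sub_vert : set G;
  sub_edges : set (G * G);
  sub_edges_sub : sub_edges `<=` edges G;
  sub_edges_vert : sub_edges `<=` sub_vert `*` sub_vert;
  sub_edges_sym :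
    kd = Undirected -> forall u v, sub_edges (u, v) -> sub_edges (v, u)
}.
Arguments sub_vert {kd G} s _.
Arguments sub_edges {kd G} s _.

Definition graph_of_subgraph (kd : graph_kind) (G : graph kd)
    (S : subgraph G) : graph kd :=
  @Graph kd (set_type (sub_vert S))
    [set e | sub_edges S (val e.1, val e.2)]
    (fun und u v => @sub_edges_sym kd G S und (val u) (val v)).

Coercion graph_of_subgraph : subgraph >-> graph.

Definition is_union (kd : graph_kind) (G : graph kd) (k : nat)
    (F : 'I_k -> subgraph G) : Prop :=
  [set: G] = \bigcup_i sub_vert (F i) /\
  edges G = \bigcup_i sub_edges (F i).

Definition same_edge (kd : graph_kind) (T : Type) (e e' : T * T) : Prop :=
  match kd with
  | Undirected => e = e' \/ e = (e'.2, e'.1)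
  | Directed => e = e'
  end.

Definition is_hom (kd : graph_kind) (G H : graph kd) (f : G -> H) : Prop :=
  forall u v, edges G (u, v) -> edges H (f u, f v).

Definition is_inj_hom (kd : graph_kind) (G H : graph kd) (f : G -> H) : Prop :=
  [/\ is_hom f,
      injective f &
      forall e e', edges G e -> edges G e' ->
        same_edge kd (f e.1, f e.2) (f e'.1, f e'.2) -> same_edge kd e e'].

Definition has_hom (kd : graph_kind) (G H : graph kd) : Prop :=
  exists f : G -> H, is_hom f.

Definition has_inj_hom (kd : graph_kind) (G H : graph kd) : Prop :=
  exists f : G -> H, is_inj_hom f.

Inductive enat := Fin of nat | Infty.

Definition enat_le (x y : enat) : bool :=
  match x, y with
  | _, Infty => true
  | Infty, Fin _ => false
  | Fin m, Fin n => m <= n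
  end.

(* In particular Fin 0 times Infty is Infty. *)
Definition enat_mul (x y : enat) : enat :=
  match x, y with
  | Fin m, Fin n => Fin (m * n)
  | _, _ => Infty
  end.

Declare Scope enat_scope.
Delimit Scope enat_scope with enat.
Bind Scope enat_scope with enat.
Notation "x <= y" := (enat_le x y) : enat_scope.
Notation "x * y" := (enat_mul x y) : enat_scope.

Definition least (P : nat -> Prop) : enat :=
  match pselect (exists k, `[< P k >]) with
  | left exP => Fin (ex_minn exP)
  | right _ => Infty
  end.

Definition decomposes (kd : graph_kind) (maps_to : graph kd -> graph kd -> Prop)
    (G H : graph kd) (k : nat) : Prop :=
  0 < k /\
  exists F : 'I_k -> subgraph G, is_union F /\ forall i, maps_to (F i) H.

Definition hom_complexity (kd : graph_kind) (G H : graph kd) : enat :=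
  least (decomposes (@has_hom kd) G H).

Definition inj_hom_complexity (kd : graph_kind) (G H : graph kd) : enat :=
  least (decomposes (@has_inj_hom kd) G H).

(* Main.v *)
(** If [f i] maps the piece [G_i] of [G] to [H] and the [H_j] decompose [H],
    then the pieces "[f i]-preimage of [H_j] in [G_i]" decompose [G], and the
    restriction of [f i] to such a piece followed by [H_j -> K] maps it to [K]. *)
Require Import Defs.
From mathcomp Require Import all_boot boolp classical_sets.

Set Implicit Arguments.
Unset Strict Implicit.
Unset Printing Implicit Defensive.

Local Open Scope classical_set_scope.

Section Preimage.
Variables (kd : graph_kind) (G H : graph kd) (S : subgraph G) (f : S -> H).
Variable T : subgraph H.

Let pre_vert : set G := [set val x | x in f @^-1` sub_vert T].

(** These are not all edges induced on [pre_vert]: the image must be an edge of [T], so that [f]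
    restricts to a homomorphism into [T] and not just into [H]. *)
Let pre_edges : set (G * G) :=
  [set (val p.1, val p.2) | p in
    edges S `&` [set p | sub_edges T (f p.1, f p.2)]].

Let pre_edges_sub : pre_edges `<=` edges G.
Proof. by move=> _ [p [pS _] <-]; apply: sub_edges_sub pS. Qed.

Let pre_edges_vert : pre_edges `<=` pre_vert `*` pre_vert.
Proof.
move=> _ [[x y] [_ /sub_edges_vert [/= Tx Ty]] <-].
by split; [exists x | exists y].
Qed.

Let pre_edges_sym :
  kd = Undirected -> forall u v, pre_edges (u, v) -> pre_edges (v, u).
Proof.
move=> und u v [[x y] [/= /(sub_edges_sym und) Syx]].
move=> /(sub_edges_sym und) Tyx [<- <-].
by exists (y, x).
Qed.

Definition preimage_subgraph : subgraph G :=
  Subgraph pre_edges_sub pre_edges_vert pre_edges_sym.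

(** The map is the restriction of [f]. Vertices of the preimage are typed in [G], so each is first
    lifted to [S]. *)
Lemma preimage_subgraph_hom :
  exists g : preimage_subgraph -> T, is_hom g /\ (injective f -> injective g).
Proof.
have lift (x : preimage_subgraph) :
    {y : S | val y = val x /\ f y \in sub_vert T}.
  apply: cid; have /set_mem [y Ty yx] := valP x.
  by exists y; split=> //; apply/mem_set.
pose g x : T := SigSub (svalP (lift x)).2; exists g; split.
  move=> u v [[x y] [/= _ Txy] [xu yv]].
  (* A lift is determined by its value in [G], so the chosen lifts are the endpoints of the edge of
     [S] that witnesses [(u, v)]. *)
  suff [-> ->] : sval (lift u) = x /\ sval (lift v) = y by [].
  split; apply: val_inj.
    exact: etrans (svalP (lift u)).1 (esym xu).
  exact: etrans (svalP (lift v)).1 (esym yv).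
move=> f_inj u v /(congr1 val) /f_inj lift_uv; apply: val_inj.
by rewrite -(svalP (lift u)).1 -(svalP (lift v)).1 lift_uv.
Qed.

End Preimage.

Lemma is_hom_comp (kd : graph_kind) (G H K : graph kd) (f : G -> H)
  (g : H -> K) : is_hom f -> is_hom g -> is_hom (g \o f).
Proof. by move=> f_hom g_hom u v /f_hom /g_hom. Qed.

(** An edge is determined by its endpoints, so vertex injectivity carries over to edges; undirected
    edges may match directly or swapped. *)
Lemma injective_is_inj_hom (kd : graph_kind) (G H : graph kd) (f : G -> H) :
  is_hom f -> injective f -> is_inj_hom f.
Proof.
move=> f_hom f_inj; split=> // -[u v] [u' v'] _ _.
case: kd G H f {f_hom} f_inj u v u' v' => G H f f_inj u v u' v' /=.
  by case=> -[/f_inj -> /f_inj ->]; [left | right].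
by case=> /f_inj -> /f_inj ->.
Qed.

(** A vertex or edge of [G] lies in some [F i], and its image under [f i] lies in some [F' j]; any
    index that [idx] sends to [(i, j)] then covers it. *)
Lemma is_union_preimage (kd : graph_kind) (G H : graph kd) (m n k : nat)
    (F : 'I_m -> subgraph G) (F' : 'I_n -> subgraph H) (f : forall i, F i -> H)
    (idx : 'I_k -> 'I_m * 'I_n) :
    is_union F -> is_union F' -> (forall i, is_hom (f i)) ->
    (forall p, exists l, idx l = p) ->
  is_union (fun l => preimage_subgraph (f (idx l).1) (F' (idx l).2)).
Proof.
move=> [FV FE] [F'V F'E] f_hom idx_surj; split; apply/seteqP; split=> //.
- move=> v _; have : [set: G] v by [].
  rewrite FV => -[i _ Fiv].
  pose x : F i := SigSub (mem_set Fiv).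
  have : [set: H] (f i x) by [].
  rewrite F'V => -[j _ F'jx]; have [l idx_l] := idx_surj (i, j).
  by exists l => //; rewrite idx_l; exists x.
- move=> [u v]; rewrite FE => -[i _ Fiuv].
  have [Fiu Fiv] := sub_edges_vert Fiuv.
  pose x : F i := SigSub (mem_set Fiu); pose y : F i := SigSub (mem_set Fiv).
  have : edges H (f i x, f i y) by apply: f_hom.
  rewrite F'E => -[j _ F'jxy]; have [l idx_l] := idx_surj (i, j).
  by exists l => //; rewrite idx_l; exists (x, y).
- by move=> e [l _]; apply: sub_edges_sub.
Qed.

(** Keeping [maps_to] abstract serves both complexities. One [f] per piece must work for every [T],
    since the preimages of all pieces of [H] are taken under the same map. *)
Lemma decomposesM (kd : graph_kind) (maps_to : graph kd -> graph kd -> Prop)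
    (G H K : graph kd) (m n : nat) :
    (forall S : subgraph G, maps_to S H ->
      exists f : S -> H, is_hom f /\
        forall T : subgraph H, maps_to T K ->
          maps_to (preimage_subgraph f T) K) ->
  decomposes maps_to G H m -> decomposes maps_to H K n ->
  decomposes maps_to G K (m * n).
Proof.
move=> restrict [m_gt0 [F [F_union F_map]]] [n_gt0 [F' [F'_union F'_map]]].
split; first by rewrite muln_gt0 m_gt0.
pose f i := cid (restrict _ (F_map i)).
(* With [m * n] read as a cardinal, [enum_val] enumerates the pairs of indices. *)
have -> : m * n = #|{: 'I_m * 'I_n}| by rewrite card_prod !card_ord.
exists (fun l => preimage_subgraph (sval (f (enum_val l).1))
                                   (F' (enum_val l).2)).
split=> [|l]; last exact: (svalP (f _)).2.
have f_hom i : is_hom (sval (f i)) := (svalP (f i)).1.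
apply: (is_union_preimage (idx := enum_val) F_union F'_union f_hom) => p.
by exists (enum_rank p); rewrite enum_rankK.
Qed.

(** If [P] or [Q] never holds, the right side is [Infty]. Otherwise [R] holds at the product of the
    two minima, which bounds its own minimum. *)
Lemma least_leM (P Q R : nat -> Prop) :
    (forall m n, P m -> Q n -> R (m * n)) ->
  (least R <= least P * least Q)%enat.
Proof.
rewrite /least => PQR.
case: (pselect (exists k, `[< P k >])) => [exP|_] /=; last by case: pselect.
case: (pselect (exists k, `[< Q k >])) => [exQ|_] /=; last by case: pselect.
case: ex_minnP => m /asboolP Pm _; case: ex_minnP => n /asboolP Qn _.
have Rmn : `[< R (m * n) >] by apply/asboolP/PQR.
case: pselect => [exR | []] /=; last by exists (m * n).
by case: ex_minnP => k _; apply.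
Qed.

Theorem theorem3p7 (kd : graph_kind) (G H K : graph kd) :
  (hom_complexity G K <= hom_complexity G H * hom_complexity H K)%enat /\
  (inj_hom_complexity G K
     <= inj_hom_complexity G H * inj_hom_complexity H K)%enat.
Proof.
split; apply: least_leM => m n; apply: decomposesM => S.
  move=> [f f_hom]; exists f; split=> // T [h h_hom].
  have [g [g_hom _]] := preimage_subgraph_hom f T.
  by exists (h \o g); apply: is_hom_comp.
move=> [f [f_hom f_inj _]]; exists f; split=> // T [h [h_hom h_inj _]].
have [g [g_hom g_inj]] := preimage_subgraph_hom f T.
(* Vertex injectivity survives restriction and composition, and injectivity on edges follows from
   it. *)
exists (h \o g); apply: injective_is_inj_hom; first exact: is_hom_comp.
exact: inj_comp h_inj (g_inj f_inj).
Qed.
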